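(* Let $G$ be a non-bipartite connected cactus graph, with cover ideal $J(G)$, and let $n$ be the number of vertices of a smallest induced odd cycle in $G$. Then $\displaystyle\rho(J(G))=\rho_a(J(G))=\frac{n+1}{n}$. Moreover, $J(G)^{(nt+t)}\subset J(G)^{nt}$ for all $t\ge1$.
   Context: All graphs are finite and simple, with no isolated vertices. A block of a graph is a maximal induced subgraph without a cut vertex; a cactus graph is a graph each of whose blocks is either a cycle or an edge. The cover ideal $J(G)$ of a graph $G$, over a field $\mathbb{K}$, is the ideal of $\mathbb{K}[x : x\in V(G)]$ generated by the monomials $\prod_{x\in\Gamma}x$, $\Gamma$ a vertex cover of $G$; equivalently $J(G)=\bigcap_{\{x,y\}\in E(G)}(x,y)$. For an ideal $I$ in a Noetherian ring $R$, $I^{(s)}=\bigcap_{P\in\mathrm{Ass}(I)}(I^sR_P\cap R)$ is the $s$-th symbolic power. The resurgence and asymptotic resurgence are $\rho(I)=\sup\{s/t : s,t\in\mathbb{N},\ I^{(s)}\not\subset I^t\}$ and $\rho_a(I)=\sup\{s/t : s,t\in\mathbb{N},\ I^{(sr)}\not\subset I^{tr}\text{ for all } r\gg0\}$, where $\mathbb{N}$ denotes the positive integers. *)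

(* Defs.v *)
From HB Require Import structures.
(* The notations of mpoly clash with those of mathcomp-analysis, and its
   [symmetric] would hide that of ssrbool if it were imported last. *)
From mathcomp Require Import -(notations) mpoly.
From mathcomp Require Import all_boot all_order all_algebra.
From mathcomp Require Import boolp classical_sets reals constructive_ereal ereal.

Set Implicit Arguments.
Unset Strict Implicit.
Unset Printing Implicit Defensive.

Import Order.TTheory GRing.Theory Num.Theory.

Local Open Scope ring_scope.

(* A graph on the finite vertex type V is given by its adjacency relation e;
   e is assumed to satisfy [simple_graph] wherever it is used. *)
Definition simple_graph (V : finType) (e : rel V) : Prop :=
  symmetric e /\ irreflexive e.

Definition no_isolated_vertex (V : finType) (e : rel V) : Prop :=
  forall x, exists y, e x y.

Definition induced (V : finType) (e : rel V) (S : {set V}) : rel V :=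
  [rel x y | [&& x \in S, y \in S & e x y]].

Definition connected_on (V : finType) (e : rel V) (S : {set V}) : bool :=
  [forall x in S, forall y in S, connect (induced e S) x y].

Definition connected_graph (V : finType) (e : rel V) : Prop :=
  (0 < #|V|)%N /\ connected_on e [set: V]%SET.

Definition bipartite (V : finType) (e : rel V) : Prop :=
  exists A : {set V}, forall x y, e x y -> (x \in A) != (y \in A).

(* v is a cut vertex of the subgraph induced on S when deleting v separates
   two other vertices lying in the same component of that subgraph. *)
Definition cut_vertex (V : finType) (e : rel V) (S : {set V}) (v : V) : bool :=
  (v \in S) &&
  [exists x in (S :\ v)%SET, exists y in (S :\ v)%SET,
     connect (induced e S) x y && ~~ connect (induced e (S :\ v)%SET) x y].

(* Blocks are connected by convention; without this requirement two far apart
   vertices of a path would form an induced subgraph without a cut vertex. *)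
Definition block (V : finType) (e : rel V) (B : {set V}) : bool :=
  maxset (fun S => connected_on e S && [forall v, ~~ cut_vertex e S v]) B.

Definition is_edge (V : finType) (e : rel V) (S : {set V}) : Prop :=
  exists x y, e x y /\ S = [set x; y]%SET.

(* The subgraph induced on S is a cycle: its vertices can be listed cyclically
   so that adjacency is exactly being consecutive. *)
Definition induced_cycle (V : finType) (e : rel V) (S : {set V}) : Prop :=
  exists c : seq V,
    [/\ (3 <= size c)%N, uniq c, S = [set x in c]%SET
      & {in c &, forall x y, e x y = (y == next c x) || (x == next c y)}].

Definition cactus (V : finType) (e : rel V) : Prop :=
  forall B : {set V}, block e B -> induced_cycle e B \/ is_edge e B.

Definition smallest_induced_odd_cycle_size
    (V : finType) (e : rel V) (n : nat) : Prop :=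
  (exists S : {set V}, [/\ induced_cycle e S, odd #|S| & #|S| = n]) /\
  (forall S : {set V}, induced_cycle e S -> odd #|S| -> (n <= #|S|)%N).

Definition vertex_cover (V : finType) (e : rel V) (C : {set V}) : bool :=
  [forall x, forall y, e x y ==> ((x \in C) || (y \in C))].

Local Open Scope classical_set_scope.

Section Ideals.
Variable A : comNzRingType.
Implicit Types (G I P : set A) (s t : nat).

Definition ideal_gen G : set A :=
  [set f | exists (k : nat) (c g : 'I_k -> A),
     (forall i, G (g i)) /\ f = \sum_(i < k) c i * g i].

Definition ideal_pow I s : set A :=
  ideal_gen [set f | exists g : 'I_s -> A,
     (forall i, I (g i)) /\ f = \prod_(i < s) g i].

Definition is_ideal I : Prop :=
  [/\ I 0, (forall f g, I f -> I g -> I (f + g)) &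
      (forall c f, I f -> I (c * f))].

Definition is_prime P : Prop :=
  [/\ is_ideal P, ~ P 1 & forall f g, P (f * g) -> P f \/ P g].

Definition associated_prime I P : Prop :=
  is_prime P /\ exists f, P = [set g | I (g * f)].

(* The contraction I A_P `&` A of the extension of the ideal I to the
   localization A_P : f / 1 lies in I A_P iff u * f is in I for some u
   outside P. *)
Definition local_contraction I P : set A :=
  [set f | exists2 u, ~ P u & I (u * f)].

Definition symbolic_pow I s : set A :=
  \bigcap_(P in associated_prime I) local_contraction (ideal_pow I s) P.

Definition resurgence (R : realType) I : \bar R :=
  ereal_sup [set q | exists s t, [/\ (0 < s)%N, (0 < t)%N,
     ~ (symbolic_pow I s `<=` ideal_pow I t) & q = (s%:R / t%:R)%:E]].

Definition asymptotic_resurgence (R : realType) I : \bar R :=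
  ereal_sup [set q | exists s t, [/\ (0 < s)%N, (0 < t)%N,
     (exists r0 : nat, forall r, (r0 <= r)%N ->
        ~ (symbolic_pow I (s * r) `<=` ideal_pow I (t * r)))
     & q = (s%:R / t%:R)%:E]].

End Ideals.

(* K[x : x in V] is mpoly #|V| K, also written {mpoly K[#|V|]}, with the
   variables indexed through enum_rank. *)
Definition vertex_var (K : fieldType) (V : finType) (x : V) : mpoly #|V| K :=
  mpolyX K (mnm1 (enum_rank x)).

Definition cover_ideal (K : fieldType) (V : finType) (e : rel V) :
    set (mpoly #|V| K) :=
  ideal_gen [set f | exists2 C : {set V}, vertex_cover e C &
                     f = \prod_(x in C) vertex_var K x].
Arguments cover_ideal K {V} e _.

(* Main.v *)
Require Import Defs.
From HB Require Import structures.
From mathcomp Require Import -(notations) mpoly.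
From mathcomp Require Import all_boot all_order all_algebra.
From mathcomp Require Import boolp classical_sets reals constructive_ereal ereal.
From mathcomp Require Import fintype finset perm zify ring lra.

(** Everything is monomial.  The associated primes of J = J(G) are the edge
    primes (x, y), so a polynomial lies in J^(s) only if each of its monomials
    x^a satisfies a_x + a_y >= s on every edge; and x^a lies in J^t as soon as
    a dominates a sum of t indicator functions of vertex covers.

    Upper bound.  Let (n+1) t <= n s and let a satisfy a_x + a_y >= s on the
    edges.  Finding t covers C_i whose sum is below a amounts, on taking
    complements, to giving every vertex x a set D_x of b_x = max(0, t - a_x)
    colours out of t, adjacent vertices receiving disjoint sets
    ([cover_decomposition]).  Such a multicolouring can be built block by block:
    two colourings meeting in one cut vertex agree there after a permutation of
    the colours ([multicoloring_from_blocks]).  In a cactus only edges and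
    cycles remain.  Going around a cycle of length m, the vertices receive
    consecutive arcs of the circle Z/t, with gaps chosen such that the walk
    closes up after floor(m/2) turns; this is possible when adjacent demands sum
    to at most t and the total demand is at most floor(m/2) t
    ([multicoloring_cyclic]).  The first condition follows from t <= s.  The
    second is clear by pairing neighbours if m is even or if some demand
    vanishes; otherwise m is odd, adjacent demands sum to at most 2t - s, and
    the total is at most m (2t - s) / 2 <= (m - 1) t / 2 because
    (m+1)/m <= (n+1)/n <= s/t ([sum_deficit_cycle]).

    Lower bound.  The product of the k-th powers of all variables lies in
    J^(2k) ([constant_monomial_symbolic]), and its degree in the variables of an
    odd cycle of length n is kn, whereas any cover has at least (n+1)/2
    vertices on the cycle.  So J^(2k) is not inside J^t once
    2kn < t (n+1) ([symbolic_pow_even_not_sub]), and the ratios 2k/t allowed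
    here come arbitrarily close to (n+1)/n while being stable under
    multiplying 2k and t by a common factor, which serves the asymptotic
    resurgence as well. *)

Import Order.TTheory GRing.Theory Num.Theory.

(** * Multicolourings and sums of vertex covers *)

Section Multicolorings.
Set Implicit Arguments.
Unset Strict Implicit.
Local Open Scope nat_scope.

(** In the application D x collects the indices i < t of those covers C_i that
    omit x: the C_i are vertex covers exactly when the D x of adjacent vertices
    are disjoint.  Demanding cardinality b x, not just at least b x, is
    what lets two colourings be matched at a common vertex. *)
Definition multicoloring (V : finType) (e : rel V) (t : nat) (b : V -> nat)
    (S : {set V}) (D : V -> {set 'I_t}) : Prop :=
  {in S, forall x, #|D x| = b x} /\
  {in S &, forall x y, e x y -> [disjoint D x & D y]}.

(** The indicator tuples of A and B contain equally many entries true, hence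
    are permutations of one another. *)
Lemma perm_equicardinal t (A B : {set 'I_t}) :
  #|A| = #|B| -> exists s : {perm 'I_t}, s @: A = B.
Proof.
move=> eqAB.
have /tuple_permP[p Ep] :
    perm_eq [tuple i \in A | i < t] [tuple i \in B | i < t].
  apply/seq.permP => a; rewrite !count_map.
  have count_mem_set (X : {set 'I_t}) :
      count (preim (fun i => i \in X) a) (enum 'I_t)
      = a true * #|X| + a false * #|~: X|.
    rewrite !cardE /enum_mem -!enumT !size_filter.
    elim: (enum 'I_t) => [|i l IH] /=; first by rewrite !muln0.
    by rewrite {}IH !inE /=; case: (i \in X); case: (a true); case: (a false);
      rewrite /=; lia.
  rewrite -!enumT; apply: (etrans (count_mem_set A)).
  apply: etrans (esym (count_mem_set B)).
  have CA := cardsC A; have CB := cardsC B.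
  by congr (_ * _ + _ * _); lia.
exists p; apply/eqP; rewrite eqEcard card_imset; last exact: perm_inj.
rewrite eqAB leqnn andbT; apply/subsetP => _ /imsetP[i iA ->].
have /(congr1 (fun l => tnth l i)) : [tuple i \in A | i < t] =
    [tuple tnth [tuple i \in B | i < t] (p i) | i < t] by exact: val_inj Ep.
by rewrite !tnth_mktuple iA => <-.
Qed.

(** Permute the colours on S2 so that the two colourings agree at v, the only
    vertex where they could conflict. *)
Lemma multicoloring_glue (V : finType) (e : rel V) t b (S1 S2 : {set V}) v :
  symmetric e ->
  (forall x, x \in S1 -> x \in S2 -> x = v) ->
  (forall x y, x \in S1 -> y \in S2 -> e x y -> (x \in S2) || (y \in S1)) ->
  (exists D, @multicoloring V e t b S1 D) ->
  (exists D, @multicoloring V e t b S2 D) ->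
  exists D, @multicoloring V e t b (S1 :|: S2) D.
Proof.
move=> e_sym S12v e12 [D1 [card1 dis1]] [D2 [card2 dis2]].
have [s Es] : exists s : {perm 'I_t},
    forall x, x \in S1 -> x \in S2 -> s @: D2 x = D1 x.
  have [/andP[v1 v2]|nv] := boolP ((v \in S1) && (v \in S2)).
    have [|s Es] := @perm_equicardinal t (D2 v) (D1 v).
      by rewrite card1 ?card2.
    by exists s => x x1 x2; rewrite (S12v x x1 x2).
  exists 1%g => x x1 x2; case/negP: nv.
  by rewrite -(S12v x x1 x2) x1 x2.
pose D x := if x \in S1 then D1 x else s @: D2 x.
have DE2 x : x \in S2 -> D x = s @: D2 x.
  by rewrite /D; case: ifP => // x1 x2; rewrite Es.
have DE1 x : x \in S1 -> D x = D1 x by rewrite /D => ->.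
have disj12 x y : x \in S1 -> y \in S2 -> e x y -> [disjoint D x & D y].
  move=> x1 y2 exy; have /orP[x2|y1] := e12 _ _ x1 y2 exy.
    by rewrite !DE2 // imset_disjoint ?dis2 //; apply: perm_inj.
  by rewrite !DE1 // dis1.
exists D; split=> [x|x y]; rewrite !inE.
  case/orP => xS; first by rewrite DE1 ?card1.
  by rewrite DE2 // card_imset ?card2 //; apply: perm_inj.
case/orP=> xS /orP[] yS exy.
- by rewrite !DE1 // dis1.
- exact: disj12.
- by rewrite disjoint_sym disj12 // e_sym.
- by rewrite !DE2 // imset_disjoint ?dis2 //; apply: perm_inj.
Qed.

(** Strong induction on vertex sets S: if S is disconnected or has a cut vertex,
    glue the colourings of two smaller sets; otherwise S is contained in a block
    and inherits its colouring.  Working with all S, and not with the tree of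
    blocks, avoids describing how blocks meet. *)
Lemma multicoloring_from_blocks (V : finType) (e : rel V) t b :
  symmetric e ->
  (forall B, block e B -> exists D, @multicoloring V e t b B D) ->
  exists D, @multicoloring V e t b [set: V] D.
Proof.
move=> e_sym colB.
suff col m (S : {set V}) : #|S| < m -> exists D, @multicoloring V e t b S D.
  exact: (col #|[set: V]|.+1).
elim: m S => // m IH S; rewrite ltnS => leSm.
case Sconn: (connected_on e S); last first.
  move/negbT: Sconn; rewrite negb_forall => /existsP[x].
  rewrite negb_imply negb_forall => /andP[xS /existsP[y]].
  rewrite negb_imply => /andP[yS nxy].
  pose A := [set z in S | connect (induced e S) x z].
  have AS : A \subset S by apply/subsetP => z; rewrite inE => /andP[].
  have -> : S = A :|: S :\: A.
    by apply/setP => z; rewrite !inE; case: (z \in S); rewrite //= andbT orbN.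
  apply: (@multicoloring_glue _ _ _ _ _ _ x) => //.
  - by move=> z zA; rewrite in_setD zA.
  - move=> z w; rewrite !inE => /andP[zS xz] /andP[+ wS] ezw.
    rewrite wS /= => /negP[].
    have zw : induced e S z w by rewrite /induced /= zS wS.
    exact: connect_trans xz (connect1 zw).
  - apply: IH; apply: leq_trans leSm; apply: proper_card; apply/properP.
    by split=> //; exists y; rewrite // inE yS.
  apply: IH; apply: leq_trans leSm; apply: proper_card; apply/properP.
  by split; [apply: subsetDl | exists x; rewrite // !inE xS connect0].
case: (boolP [forall v, ~~ cut_vertex e S v]) => [Sncut|].
  have [|B maxB SB] := @maxset_exists _
    (fun S => connected_on e S && [forall v, ~~ cut_vertex e S v]) S.
    by rewrite Sconn.
  have [D [cardD disD]] := colB B maxB.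
  exists D; split=> [x xS|x y xS yS]; first by rewrite cardD ?(subsetP SB).
  by apply: disD; apply: (subsetP SB).
rewrite negb_forall => /existsP[v]; rewrite negbK => /andP[vS].
case/existsP=> x /andP[xS' /existsP[y /and3P[yS' _ nxy]]].
have xS : x \in S by case/setD1P: xS'.
have yS : y \in S by case/setD1P: yS'.
pose A := [set z in S :\ v | connect (induced e (S :\ v)) x z].
have vA : v \notin A by rewrite !inE eqxx.
have AS : A \subset S.
  by apply/subsetP => z; rewrite !inE => /andP[/andP[]].
have xA : x \in A by rewrite inE xS' connect0.
have yA : y \notin A by rewrite inE yS'.
have -> : S = (v |: A) :|: S :\: A.
  apply/setP => z; rewrite in_setU in_setU1 in_setD.
  case: eqP => [->|_] //=.
  by have [/(subsetP AS) ->|] := boolP (z \in A).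
apply: (@multicoloring_glue _ _ _ _ _ _ v) => //.
- move=> z; rewrite in_setU1 in_setD => /orP[/eqP //|zA].
  by rewrite zA.
- move=> z w; rewrite !in_setU1 !in_setD => /orP[/eqP->|zA].
    by rewrite vA vS.
  move=> /andP[wA wS] ezw; case: (eqVneq w v) => [|wv]; first by rewrite orbT.
  case/negP: wA; move: zA; rewrite ![_ \in A]inE => /andP[zS' xz].
  have wS' : w \in S :\ v by rewrite !inE wv.
  have zw : induced e (S :\ v) z w by rewrite /induced /= zS' wS'.
  by rewrite wS'; exact: connect_trans xz (connect1 zw).
- apply: IH; apply: leq_trans leSm; apply: proper_card; apply/properP; split.
    by apply/subsetP => z /setU1P[->|/(subsetP AS)].
  exists y => //; rewrite in_setU1 negb_or yA andbT.
  by case/setD1P: yS'.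
apply: IH; apply: leq_trans leSm; apply: proper_card; apply/properP.
by split; [apply: subsetDl | exists x; rewrite // in_setD xA].
Qed.

(** The positions p i of arcs of lengths b i that are placed one after the
    other on a line, so that consecutive arcs stay disjoint modulo t.  The steps
    p (i+1) - p i may range over [b i, t - b (i+1)], so p m can take any value
    between the sum L m of the lower bounds and the sum U m of the upper bounds,
    and k t lies in between. *)
Lemma arc_positions (t m k : nat) (b : nat -> nat) :
  (forall i, i < m -> b i + b i.+1 <= t) -> b m = b 0 ->
  \sum_(i < m) b i <= k * t -> k + k <= m ->
  exists p : nat -> nat, [/\ p 0 = 0, p m = k * t &
    forall i, i < m -> p i + b i <= p i.+1 /\ p i.+1 + b i.+1 <= p i + t].
Proof.
move=> b_adj b_per sum_le k_le.
pose L j := \sum_(i < j) b i; pose U j := \sum_(i < j) (t - b i.+1).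
have LS j : L j.+1 = L j + b j by rewrite /L big_ord_recr.
have US j : U j.+1 = U j + (t - b j.+1) by rewrite /U big_ord_recr.
have LU j : j <= m -> U j + L j + b j = j * t + b 0.
  elim: j => [|j IH] jm; first by rewrite /U /L !big_ord0.
  by have := IH (ltnW jm); have := b_adj _ jm; rewrite LS US; lia.
have kt_le : k * t <= U m.
  by have := LU m (leqnn m); rewrite b_per; have : L m <= k * t by []; nia.
(* L starts at 0 and U, shifted down by U m - k t, ends at k t; the maximum of
   two sequences with admissible steps has admissible steps. *)
exists (fun i => maxn (L i) (U i + k * t - U m)); split.
- by rewrite [L 0]big_ord0 [U 0]big_ord0; lia.
- by have : L m <= k * t by []; lia.
by move=> i im; have := b_adj _ im; rewrite LS US; lia.
Qed.

Lemma index_next (T : eqType) (c : seq T) x : uniq c -> x \in c ->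
  index (next c x) c = if (index x c).+1 < size c then (index x c).+1 else 0.
Proof.
move=> Uc xc; rewrite next_nth xc; case: c Uc xc => // y p Uc xc.
set i := index x _; rewrite ltnS; case: ltnP => ip.
  by rewrite -[nth y p i]/(nth y (y :: p) i.+1) index_uniq.
by rewrite nth_default // /= eqxx.
Qed.

(** Place the colour sets as arcs of Z/t by [arc_positions], with k the half of
    the length of c rounded down: position k t closes the circle. *)
Lemma multicoloring_cyclic (V : finType) (t : nat) (b : V -> nat) (c : seq V) :
  0 < t -> uniq c ->
  {in c, forall x, b x + b (next c x) <= t} ->
  \sum_(x <- c) b x <= (size c)./2 * t ->
  exists D : V -> {set 'I_t}, {in c, forall x, #|D x| = b x} /\
    {in c, forall x, [disjoint D x & D (next c x)]}.
Proof.
case: t => // t _ Uc b_adj sum_le.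
case: c Uc b_adj sum_le => [|x0 c'] ; first by exists (fun=> set0).
set c := x0 :: c'; set m := size c => Uc b_adj sum_le.
(* The demands along c, extended by the first one at index m to close the
   cycle. *)
pose be i := if i < m then b (nth x0 c i) else b x0.
have be0 : be 0 = b x0 by [].
have beS i : i < m -> be i.+1 = b (next c (nth x0 c i)).
  move=> im; have xc : nth x0 c i \in c by apply: mem_nth.
  rewrite -[next c _](@nth_index _ x0 _ c) ?mem_next // index_next //.
  by rewrite index_uniq // /be -/m; case: ifP.
have [||||p [p0 pm pS]] := @arc_positions t.+1 m m./2 be.
- by move=> i im; rewrite beS // /be im b_adj // mem_nth.
- by rewrite be0 /be ltnn.
- apply: leq_trans sum_le; rewrite (big_nth x0) -/m big_mkord.
  by rewrite leq_eqVlt; apply/orP; left; apply/eqP;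
     apply: eq_bigr => i _; rewrite /be ltn_ord.
- by rewrite addnn; lia.
pose D i : {set 'I_t.+1} := [set inZp (p i + q) | q : 'I_(be i)].
have be_le i : i < m -> be i <= t.+1.
  by move=> im; have := pS i im; lia.
have cardD i : i < m -> #|D i| = be i.
  move=> im; rewrite card_imset ?card_ord // => q q' /(congr1 val) /= /eqP.
  rewrite eqn_modDl !modn_small => [/eqP /val_inj //||].
    by apply: leq_trans (ltn_ord q') (be_le i im).
  by apply: leq_trans (ltn_ord q) (be_le i im).
have disD i : i < m -> [disjoint D i & D i.+1].
  move=> im; apply/pred0P => z /=; apply/negP => /andP[/imsetP[q _ ->]].
  case/imsetP=> q' _ /(congr1 val) /= /esym/eqP.
  have [lo hi] := pS i im; have := ltn_ord q; have := ltn_ord q' => hq' hq.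
  rewrite eqn_mod_dvd; last by lia.
  by move/dvdn_leq => H; have := H ltac:(lia); lia.
have Dm : D m = D 0.
  have Eb : be m = be 0 by rewrite /be ltnn.
  rewrite /D pm p0 Eb; apply: eq_imset => q; apply: val_inj => /=.
  by rewrite modnMDl.
exists (fun x => D (index x c)); split=> x xc.
  by rewrite cardD ?index_mem // /be index_mem xc nth_index.
rewrite index_next // -/m; case: ltnP => [_|mi].
  by rewrite disD ?index_mem.
have im : index x c < m by rewrite index_mem.
by rewrite -Dm (_ : m = (index x c).+1) ?disD //; lia.
Qed.

Lemma sum_path_pairs (T : eqType) t (b : T -> nat) (l : seq T) :
  ~~ odd (size l) -> sorted (fun x y => b x + b y <= t) l ->
  \sum_(x <- l) b x <= (size l)./2 * t.
Proof.
have [m] := ubnP (size l); elim: m l => // m IH [|x [|y l]] //=.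
  by rewrite big_nil.
rewrite !ltnS negbK => lm l_even /andP[bxy pl]; rewrite !big_cons.
have : \sum_(z <- l) b z <= (size l)./2 * t.
  by apply: IH => //; [lia | apply: path_sorted pl].
by lia.
Qed.

Lemma sum_next (V : finType) (F : V -> nat) (c : seq V) : uniq c ->
  \sum_(x <- c) F (next c x) = \sum_(x <- c) F x.
Proof.
move=> Uc; rewrite !(big_uniq _ Uc) /=.
rewrite [RHS](reindex_inj (can_inj (prev_next Uc))).
by apply: eq_bigl => x; rewrite mem_next.
Qed.

(** The demands t - a x around a cycle meet the bound that
    [multicoloring_cyclic] asks for. *)
Lemma sum_deficit_cycle (V : finType) (e : rel V) (n s t : nat) (a : V -> nat)
    (c : seq V) :
  (forall x y, e x y -> s <= a x + a y) -> 0 < n -> n.+1 * t <= n * s ->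
  uniq c -> {in c, forall x, e x (next c x)} -> (odd (size c) -> n <= size c) ->
  \sum_(x <- c) (t - a x) <= (size c)./2 * t.
Proof.
move=> a_cov n_gt0 nts Uc e_next n_le.
have ts : t <= s by nia.
pose r := fun x y => (t - a x) + (t - a y) <= t.
have r_cycle : cycle r c.
  apply: cycle_from_next => // x xc.
  by have := a_cov _ _ (e_next x xc); rewrite /r; lia.
have cycle_sorted l : cycle r l -> sorted r l.
  by case: l => //= x l; rewrite rcons_path => /andP[].
case: (boolP (odd (size c))) => c_odd; last first.
  exact: sum_path_pairs (cycle_sorted _ r_cycle).
(* A vertex without demand can be deleted, which leaves a path with an even
   number of vertices. *)
case: (boolP (has (fun x => t <= a x) c)) => [/hasP[x xc tx]|/hasPn lt_at].
  have [i p Ep] := rot_to xc.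
  have size_c : size c = (size p).+1 by rewrite -(size_rot i) Ep.
  have -> : \sum_(x <- c) (t - a x) = \sum_(x <- p) (t - a x).
    rewrite -(perm_big _ (permEl (perm_rot i c))) Ep big_cons.
    by rewrite (eqP tx).
  have p_even : ~~ odd (size p) by move: c_odd; rewrite size_c.
  have -> : (size c)./2 = (size p)./2 by rewrite size_c; lia.
  apply: sum_path_pairs => //; apply: (@path_sorted _ _ x).
  by move: r_cycle; rewrite -(rot_cycle i) Ep /= rcons_path => /andP[].
(* All the demands are positive, so none of the subtractions is truncated and
   the edge inequalities can be added up around the cycle. *)
have : \sum_(x <- c) ((t - a x) + (t - a (next c x)) + s)
       <= \sum_(x <- c) (t + t).
  rewrite !big_seq; apply: leq_sum => x xc.
  have xc' : next c x \in c by rewrite mem_next.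
  have := a_cov _ _ (e_next x xc); have := lt_at _ xc; have := lt_at _ xc'.
  by rewrite -!ltnNge; lia.
rewrite !big_split /= (sum_next (fun x => t - a x)) //.
rewrite !big_const_seq !count_predT !iter_addn !addn0.
have := n_le c_odd; move: (\sum_(x <- c) _) => A.
have -> : size c = (size c)./2.*2.+1 by rewrite -[LHS]odd_double_half c_odd.
move: (size c)./2 => k; nia.
Qed.

(** The combinatorial form of the containment of J^(s) in J^t: the complements
    of the colour classes of a multicolouring with demands t - a x are t vertex
    covers, and x lies in t - (t - a x) <= a x of them. *)
Lemma cover_decomposition (V : finType) (e : rel V) (n s t : nat)
    (a : V -> nat) :
  simple_graph e -> cactus e -> 0 < n ->
  (forall S, induced_cycle e S -> odd #|S| -> n <= #|S|) ->
  0 < t -> n.+1 * t <= n * s ->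
  (forall x y, e x y -> s <= a x + a y) ->
  exists C : 'I_t -> {set V}, (forall i, vertex_cover e (C i)) /\
    forall x, \sum_(i < t) (x \in C i) <= a x.
Proof.
move=> [e_sym e_irr] e_cactus n_gt0 n_min t_gt0 nts a_cov.
have ts : t <= s by nia.
pose b x := t - a x.
have b_edge x y : e x y -> b x + b y <= t by move/a_cov; rewrite /b; lia.
have [B blockB|D [cardD disD]] := @multicoloring_from_blocks V e t b e_sym.
  have col_c (c : seq V) : uniq c -> B = [set x in c] ->
      {in c, forall x, e x (next c x)} ->
      {in c &, forall x y, e x y -> (y == next c x) || (x == next c y)} ->
      \sum_(x <- c) b x <= (size c)./2 * t ->
      exists D, @multicoloring V e t b B D.
    move=> Uc -> e_next e_adj sum_le.
    have [|D [cardD disD]] := multicoloring_cyclic t_gt0 Uc _ sum_le.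
      by move=> x xc; apply/b_edge/e_next.
    exists D; split=> [x|x y]; rewrite !inE; first exact: cardD.
    move=> xc yc /(e_adj _ _ xc yc) /orP[] /eqP ->; first exact: disD.
    by rewrite disjoint_sym disD.
  case: (e_cactus B blockB) => [Bcyc|[x [y [exy BE]]]].
    have [c [c_ge3 Uc BE e_c]] := Bcyc.
    have e_next : {in c, forall x, e x (next c x)}.
      by move=> x xc; rewrite e_c ?mem_next // eqxx.
    have cardB : #|B| = size c.
      by rewrite BE; apply/eqP; rewrite cardsE; apply/eqP/card_uniqP.
    apply: (col_c c) => //; first by move=> x y xc yc; rewrite e_c.
    apply: (@sum_deficit_cycle _ e n s) => // c_odd.
    by rewrite -cardB n_min // cardB.
  (* An edge is treated as a cyclic list of length two. *)
  have xy : x != y by apply: contraTneq exy => ->; rewrite e_irr.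
  apply: (col_c [:: x; y]).
  - by rewrite /= inE xy.
  - by rewrite BE; apply/setP => z; rewrite !inE.
  - move=> z; rewrite !inE => /orP[] /eqP -> /=; rewrite eqxx //.
    by rewrite eq_sym (negPf xy) e_sym.
  - move=> z w; rewrite !inE => /orP[] /eqP -> /orP[] /eqP -> /=;
    by rewrite ?e_irr // ?eqxx // ?orbT.
  - by rewrite !big_cons big_nil addn0 mul1n b_edge.
exists (fun i => [set x | i \notin D x]); split=> [i|x].
  apply/forallP => x; apply/forallP => y; apply/implyP => exy; rewrite !inE.
  rewrite -negb_and; apply/negP => /andP[iDx iDy].
  have := disD x y (in_setT x) (in_setT y) exy.
  by move/disjointFr/(_ iDx); rewrite iDy.
have := cardD x (in_setT x); rewrite /b => cDx.
rewrite (eq_bigr (fun i => (i \notin D x) : nat)) => [|i _]; last first.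
  by rewrite inE.
suff : \sum_(i < t) ((i \notin D x) : nat) + #|D x| = t.
  by move: (\sum_(_ < _) _); lia.
rewrite -sum1_card [X in _ + X]big_mkcond -big_split /=.
rewrite (eq_bigr (fun=> 1)) ?sum_nat_const ?card_ord ?muln1 // => i _.
by case: (i \in D x).
Qed.

(** Every vertex x of the cycle has x or its successor in C, so 2 |S :&: C| is
    at least the odd number |S|. *)
Lemma odd_cycle_cover (V : finType) (e : rel V) (S C : {set V}) :
  induced_cycle e S -> odd #|S| -> vertex_cover e C ->
  #|S|.+1 <= 2 * #|S :&: C|.
Proof.
move=> [c [_ Uc SE e_c]] S_odd /forallP covC.
have cardS : #|S| = size c.
  by rewrite SE; apply/eqP; rewrite cardsE; apply/eqP/card_uniqP.
have : \sum_(x <- c) 1 <= \sum_(x <- c) ((x \in C) + (next c x \in C)).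
  rewrite !big_seq; apply: leq_sum => x xc.
  have /forallP/(_ (next c x))/implyP := covC x.
  by rewrite e_c ?mem_next // eqxx => /(_ isT) /orP[] ->; lia.
rewrite big_split /= (sum_next (fun x => x \in C : nat)) // sum1_size -cardS.
have -> : \sum_(x <- c) (x \in C) = #|S :&: C|.
  rewrite big_uniq // -sum1_card -big_mkcondr.
  by apply: eq_bigl => x; rewrite SE !inE.
by move: S_odd; lia.
Qed.
End Multicolorings.

Local Open Scope ring_scope.
Local Open Scope classical_set_scope.

(** * Generated ideals *)

Section Ideals.
Set Implicit Arguments.
Unset Strict Implicit.
Variable A : comNzRingType.
Implicit Types (G I : set A).

Lemma ideal_gen_mem G g : G g -> ideal_gen G g.
Proof.
move=> Gg; exists 1%N, (fun=> 1), (fun=> g); split=> //.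
by rewrite big_ord1 mul1r.
Qed.

Lemma ideal_gen_is_ideal G : is_ideal (ideal_gen G).
Proof.
split=> [|f g [k [c [h [Gh ->]]]] [l [d [h' [Gh' ->]]]]|a f [k [c [h [Gh ->]]]]].
- by exists 0%N, (fun=> 0), (fun=> 0); split=> [[]//|]; rewrite big_ord0.
- exists (k + l)%N, (fun i => match split i with inl j => c j | inr j => d j end),
    (fun i => match split i with inl j => h j | inr j => h' j end).
  split=> [i|]; first by case: (split i).
  rewrite big_split_ord /=; congr (_ + _); apply: eq_bigr => i _.
    by rewrite (unsplitK (inl i)).
  by rewrite (unsplitK (inr i)).
exists k, (fun i => a * c i), h; split=> //.
by rewrite mulr_sumr; apply: eq_bigr => i _; rewrite mulrA.
Qed.

Lemma ideal_sum I (T : eqType) (r : seq T) (F : T -> A) :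
  is_ideal I -> (forall i, i \in r -> I (F i)) -> I (\sum_(i <- r) F i).
Proof.
move=> [I0 ID _] IF; elim: r IF => [|i r IH] IF; first by rewrite big_nil.
rewrite big_cons; apply: ID; first by apply: IF; rewrite mem_head.
by apply: IH => j jr; apply: IF; rewrite inE jr orbT.
Qed.

Lemma ideal_gen_min G I : is_ideal I -> G `<=` I -> ideal_gen G `<=` I.
Proof.
move=> idI GI f [k [c [g [Gg ->]]]]; apply: ideal_sum => // i _.
by case: idI => _ _; apply; apply: GI.
Qed.

End Ideals.

(** * Powers of the primes generated by variables *)

Section VariablePrimes.
Set Implicit Arguments.
Unset Strict Implicit.
Context {K : fieldType} {V : finType}.
Implicit Types (S : {set V}) (d s : nat) (f g u : mpoly #|V| K).

Definition weight S (m : multinom #|V|) : nat :=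
  (\sum_(x in S) m (enum_rank x))%N.

(** The d-th power of the prime ideal generated by the variables in S. *)
Definition order_ge S d : set (mpoly #|V| K) :=
  [set f | forall m, m \in msupp f -> (d <= weight S m)%N].

Lemma weightD S m1 m2 :
  weight S (mnm_add m1 m2) = (weight S m1 + weight S m2)%N.
Proof. by rewrite -big_split; apply: eq_bigr => x _; rewrite mnmDE. Qed.

Lemma msuppM_split f g m : m \in msupp (f * g) ->
  exists m1 m2, [/\ m1 \in msupp f, m2 \in msupp g & m = mnm_add m1 m2].
Proof.
by move/msuppM_le/allpairsP => [[m1 m2] /= [? ? ->]]; exists m1, m2.
Qed.

Lemma order_ge0 S f : order_ge S 0 f.
Proof. by []. Qed.

Lemma order_geM S d1 d2 f g :
  order_ge S d1 f -> order_ge S d2 g -> order_ge S (d1 + d2) (f * g).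
Proof.
move=> ff gg m /msuppM_split[m1 [m2 [/ff w1 /gg w2 ->]]].
by rewrite weightD leq_add.
Qed.

Lemma order_ge_is_ideal S d : is_ideal (order_ge S d).
Proof.
split=> [m|f g ff gg m|c f ff].
- by rewrite msupp0.
- by move/msuppD_le; rewrite mem_cat => /orP[/ff|/gg].
- by have := order_geM (@order_ge0 S c) ff.
Qed.

Lemma order_ge_pow S d I s :
  I `<=` order_ge S d -> ideal_pow I s `<=` order_ge S (s * d).
Proof.
move=> IS; apply: ideal_gen_min; first exact: order_ge_is_ideal.
move=> _ [g [Ig ->]]; elim: s g Ig => [|s IH] g Ig.
  by rewrite big_ord0 mul0n; apply: order_ge0.
by rewrite big_ord_recl mulSn; apply: order_geM; [apply: IS | apply: IH].
Qed.

Lemma weight_split S d f : exists f0 f1, [/\ f = f0 + f1,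
  forall m, m \in msupp f0 -> weight S m = d &
  forall m, m \in msupp f1 -> m \in msupp f /\ weight S m != d].
Proof.
pose F m := mcoeff m f *: mpolyX K m.
have suppF (P : pred (multinom #|V|)) m :
    m \in msupp (\sum_(k <- msupp f | P k) F k) -> m \in msupp f /\ P m.
  move=> /msupp_sum_le /flattenP[l /mapP[k]].
  rewrite mem_filter => /andP[Pk kf] -> /msuppZ_le.
  by rewrite msuppX inE => /eqP->.
exists (\sum_(k <- msupp f | weight S k == d) F k).
exists (\sum_(k <- msupp f | weight S k != d) F k); split=> [|m|m].
- by rewrite {1}(mpolyE f) (bigID (fun k => weight S k == d)).
- by move/suppF => [_ /eqP].
- exact: suppF.
Qed.

(** [order_ge S s] is primary to [order_ge S 1].  If f has a part f0 of
    weight exactly d < s and u has a nonzero part u0 of weight 0, then u0 f0 is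
    the part of u f of weight d; it must vanish, hence so does f0. *)
Lemma order_ge_cancel S s u f :
  ~ order_ge S 1 u -> order_ge S s (u * f) -> order_ge S s f.
Proof.
move=> uS ufS.
suff: forall d, (d <= s)%N -> order_ge S d f by apply.
elim=> [|d IH] ds; first exact: order_ge0.
have [f0 [f1 [Ef f0d f1d]]] := weight_split S d f.
have [u0 [u1 [Eu u00 u10]]] := weight_split S 0 u.
have f1S : order_ge S d.+1 f1.
  by move=> m /f1d[mf wd]; rewrite ltn_neqAle eq_sym wd (IH (ltnW ds) m mf).
have u1S : order_ge S 1 u1 by move=> m /u10[_]; rewrite lt0n.
have u0_neq0 : u0 != 0.
  by apply: contra_notN uS => /eqP u0E; rewrite Eu u0E add0r.
have [_ addS _] := order_ge_is_ideal S d.+1.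
suff f0_eq0 : f0 = 0 by rewrite Ef f0_eq0 add0r.
apply/eqP; rewrite -(mulrI_eq0 _ (mulfI u0_neq0)) -msupp_eq0.
have lowS : order_ge S d.+1 (u0 * f0).
  have -> : u0 * f0 = u * f - (u0 * f1 + u1 * f) by rewrite Eu Ef; ring.
  apply: (addS); first by move=> m /ufS; apply: leq_trans.
  move=> m; rewrite (perm_mem (msuppN _)); apply: (addS).
    exact: (order_geM (@order_ge0 S u0) f1S).
  exact: (order_geM u1S (IH (ltnW ds))).
case E: (msupp (u0 * f0)) => [//|m l].
have mu0f0 : m \in msupp (u0 * f0) by rewrite E mem_head.
have := lowS m mu0f0; have [m1 [m2 [/u00 w1 /f0d w2 ->]]] := msuppM_split mu0f0.
by rewrite weightD w1 w2 ltnn.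
Qed.

Lemma order_ge_prime S : is_prime (order_ge S 1).
Proof.
split; first exact: order_ge_is_ideal.
  move=> /(_ mnm0); rewrite msupp1 mem_head => /(_ isT).
  by rewrite /weight big1 // => x _; rewrite mnm0E.
move=> f g fgS; case: (pselect (order_ge S 1 f)) => [|fS]; first by left.
by right; apply: order_ge_cancel fS fgS.
Qed.

(** Exponents are indexed by vertices, so that sums of exponents can be compared
    with sums of vertex covers directly. *)
Definition monomial (a : V -> nat) : mpoly #|V| K :=
  \prod_x vertex_var K x ^+ a x.

Lemma mpolyX_monomial m : mpolyX K m = monomial (fun x => m (enum_rank x)).
Proof.
rewrite mpolyXE_id (reindex enum_rank) //=; apply: onW_bij.
exact: enum_rank_bij.
Qed.

Lemma monomialD a b : monomial (fun x => a x + b x)%N = monomial a * monomial b.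
Proof. by rewrite -big_split; apply: eq_bigr => x _; rewrite exprD. Qed.

Lemma monomial_sum t (a : 'I_t -> V -> nat) :
  \prod_(i < t) monomial (a i) = monomial (fun x => \sum_(i < t) a i x)%N.
Proof.
by rewrite exchange_big; apply: eq_bigr => x _; rewrite prodrXr.
Qed.

Lemma prod_vertex_var (C : {set V}) :
  \prod_(x in C) vertex_var K x = monomial (fun x => x \in C).
Proof.
rewrite big_mkcond; apply: eq_bigr => x _.
by case: (x \in C).
Qed.

Lemma order_ge_monomial S d a :
  order_ge S d (monomial a) <-> (d <= \sum_(x in S) a x)%N.
Proof.
pose m := Multinom [tuple a (enum_val i) | i < #|V|].
have mE x : m (enum_rank x) = a x.
  by rewrite /m multinomE tnth_mktuple enum_rankK.
have -> : monomial a = mpolyX K m.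
  by rewrite mpolyX_monomial; apply: eq_bigr => x _; rewrite mE.
have wm : weight S m = \sum_(x in S) a x by apply: eq_bigr => x _.
split=> [/(_ m)|dS k]; first by rewrite msuppX mem_head wm; apply.
by rewrite msuppX inE => /eqP ->; rewrite wm.
Qed.

Lemma ideal_monomials (I : set (mpoly #|V| K)) f :
  is_ideal I ->
  (forall m, m \in msupp f -> I (monomial (fun x => m (enum_rank x)))) -> I f.
Proof.
move=> idI If; rewrite (mpolyE f); apply: ideal_sum => // m mf.
by rewrite mpolyX_monomial -mul_mpolyC; case: idI => _ _; apply; apply: If.
Qed.
End VariablePrimes.

(** * Ordinary and symbolic powers of the cover ideal *)

Section CoverIdeal.
Set Implicit Arguments.
Unset Strict Implicit.
Context {K : fieldType} {V : finType} {e : rel V}.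
Context (e_simple : simple_graph e).

Let J : set (mpoly #|V| K) := cover_ideal K e.

Lemma sum_edge (a : V -> nat) x y : e x y ->
  (\sum_(z in [set x; y]%SET) a z = a x + a y)%N.
Proof.
have [_ e_irr] := e_simple.
move=> exy; have xy : x != y by apply: contraTneq exy => ->; rewrite e_irr.
by rewrite big_setU1 ?big_set1 // inE.
Qed.

Lemma ideal_pow_monomial s (a : V -> nat) (C : 'I_s -> {set V}) :
  (forall i, vertex_cover e (C i)) ->
  (forall x, \sum_(i < s) (x \in C i) <= a x)%N ->
  ideal_pow J s (monomial a).
Proof.
move=> covC Ca; have [_ _ mulI] := ideal_gen_is_ideal
  [set f | exists g : 'I_s -> mpoly #|V| K,
     (forall i, J (g i)) /\ f = \prod_(i < s) g i].
have -> : monomial a = monomial (fun x => a x - \sum_(i < s) (x \in C i))%N *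
    \prod_(i < s) monomial (fun x => x \in C i) :> mpoly #|V| K.
  rewrite monomial_sum -monomialD; apply: eq_bigr => x _.
  by rewrite subnK.
apply: mulI; apply: ideal_gen_mem.
exists (fun i => monomial (fun x => x \in C i)); split=> // i.
by apply: ideal_gen_mem; exists (C i); rewrite // prod_vertex_var.
Qed.

(** J is the intersection of the edge primes: the support of a monomial lying in
    all of them is a vertex cover. *)
Lemma cover_idealP f :
  J f <-> forall x y, e x y -> order_ge [set x; y]%SET 1 f.
Proof.
split=> [Jf x y exy|ef].
  apply: ideal_gen_min Jf; first exact: order_ge_is_ideal.
  move=> _ [C /forallP/(_ x)/forallP/(_ y)/implyP/(_ exy) Cxy ->].
  rewrite prod_vertex_var; apply/order_ge_monomial; rewrite sum_edge //.
  by case/orP: Cxy => ->; rewrite ?addnS.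
apply: ideal_monomials; first exact: ideal_gen_is_ideal.
move=> m mf; set a := fun x => _; pose C := [set x | (0 < a x)%N]%SET.
have -> : monomial a = monomial (fun x => a x - (x \in C))%N *
    \prod_(x in C) vertex_var K x :> mpoly #|V| K.
  rewrite prod_vertex_var -monomialD; apply: eq_bigr => x _.
  by rewrite inE; case: (a x) => // k; rewrite subnK.
have [_ _ mulI] := ideal_gen_is_ideal
  [set f | exists2 C : {set V}, vertex_cover e C &
                     f = \prod_(x in C) vertex_var K x].
apply: mulI; apply: ideal_gen_mem; exists C => //.
apply/forallP => x; apply/forallP => y; apply/implyP => exy.
by have := ef x y exy m mf; rewrite /weight sum_edge // !inE -addn_gt0.
Qed.

(** The prime (x, y) is the colon ideal of J by the product of all the other
    variables: that product meets every other edge. *)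
Lemma edge_prime_associated x y :
  e x y -> associated_prime J (order_ge [set x; y]%SET 1).
Proof.
move=> exy; split; first exact: order_ge_prime.
pose f : mpoly #|V| K := monomial (fun z => z \notin [set x; y]%SET).
have sumf (S : {set V}) :
    (\sum_(z in S) (z \notin [set x; y]%SET) = #|(S :\: [set x; y])%SET|)%N.
  rewrite -sum1_card [RHS]big_mkcond [LHS]big_mkcond.
  apply: eq_bigr => z _; rewrite !inE.
  by case: (z \in S); case: (_ || _).
exists f; apply/seteqP; split=> g /=.
  move=> gS; apply/cover_idealP => z w ezw.
  case: (boolP ([set z; w]%SET \subset [set x; y]%SET)) => [zw_sub|zwNsub].
    have zwE : [set z; w]%SET = [set x; y]%SET.
      apply/eqP; rewrite eqEcard zw_sub -!sum1_card.
      by rewrite !(sum_edge (fun=> 1%N)).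
    rewrite zwE mulrC.
    by case: (order_ge_is_ideal (K := K) [set x; y]%SET 1) => _ _; apply.
  case: (order_ge_is_ideal (K := K) [set z; w]%SET 1) => _ _; apply.
  by apply/order_ge_monomial; rewrite sumf card_gt0 setD_eq0.
move/cover_idealP/(_ x y exy); rewrite mulrC; apply: order_ge_cancel.
by move/order_ge_monomial; rewrite sumf setDv cards0.
Qed.

(** If P = (J : h) is proper, then h is outside some edge prime Q, and
    P h in Q forces P in Q.  This inclusion suffices for showing that a
    polynomial lies in a symbolic power, as a multiplier outside Q is outside
    P. *)
Lemma associated_prime_sub_edge P : associated_prime J P ->
  exists x y, e x y /\ P `<=` order_ge [set x; y]%SET 1.
Proof.
move=> [[_ P1 _] [h PE]].
have hJ : ~ J h by move=> Jh; apply: P1; rewrite PE /= mul1r.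
apply: contrapT => nP; apply: hJ; apply/cover_idealP => x y exy.
apply: contrapT => hxy; apply: nP; exists x, y; split=> // g.
rewrite PE => /cover_idealP/(_ x y exy); rewrite mulrC.
exact: order_ge_cancel.
Qed.

Lemma symbolic_pow_order s f x y :
  e x y -> symbolic_pow J s f -> order_ge [set x; y]%SET s f.
Proof.
move=> exy /(_ _ (edge_prime_associated exy)) [u uP uf].
apply: order_ge_cancel uP _; rewrite -[s]muln1.
by apply: order_ge_pow uf => g /cover_idealP; apply.
Qed.

(** At an edge {x, y}, multiply by the k-th powers of the other variables: the
    result is the product of k copies of the cover V - x and k copies of the
    cover V - y. *)
Lemma constant_monomial_symbolic k :
  symbolic_pow J (k + k) (monomial (fun=> k)).
Proof.
have [_ e_irr] := e_simple.
move=> P /associated_prime_sub_edge[x [y [exy PS]]].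
have xy : x != y by apply: contraTneq exy => ->; rewrite e_irr.
exists (monomial (fun z => if z \in [set x; y]%SET then 0 else k)%N).
  move/PS/order_ge_monomial; rewrite sum_edge // !inE !eqxx orbT.
  by rewrite addn0.
rewrite -monomialD.
pose C (i : 'I_(k + k)) :=
  match split i with inl _ => [set~ x]%SET | inr _ => [set~ y]%SET end.
apply: (ideal_pow_monomial (C := C)) => [i|z].
  apply/forallP => z; apply/forallP => w; apply/implyP => ezw.
  have zw : z != w by apply: contraTneq ezw => ->; rewrite e_irr.
  rewrite /C; case: (split i) => _; rewrite !inE -negb_and;
  by apply: contra zw => /andP[/eqP-> /eqP->].
rewrite big_split_ord /=.
under eq_bigr do rewrite /C (unsplitK (inl _)).
under [X in (_ + X)%N]eq_bigr do rewrite /C (unsplitK (inr _)).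
rewrite !sum_nat_const card_ord !inE.
have [->|zx] := eqVneq z x; first by rewrite (negPf xy); lia.
by case: (z == y); rewrite /=; lia.
Qed.

Lemma symbolic_pow_sub n s t :
  cactus e -> (0 < n)%N ->
  (forall S, induced_cycle e S -> odd #|S| -> (n <= #|S|)%N) ->
  (0 < t)%N -> (n.+1 * t <= n * s)%N ->
  symbolic_pow J s `<=` ideal_pow J t.
Proof.
move=> e_cactus n_gt0 n_min t_gt0 nts f fs.
apply: ideal_monomials => [|m mf]; first exact: ideal_gen_is_ideal.
have [|C [covC Ca]] := @cover_decomposition V e n s t
  (fun x => m (enum_rank x)) e_simple e_cactus n_gt0 n_min t_gt0 nts.
  move=> x y exy; have := symbolic_pow_order exy fs mf.
  by rewrite /weight sum_edge.
exact: ideal_pow_monomial covC Ca.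
Qed.

Lemma symbolic_pow_even_not_sub S k t :
  induced_cycle e S -> odd #|S| -> (#|S| * (k + k) < #|S|.+1 * t)%N ->
  ~ (symbolic_pow J (k + k) `<=` ideal_pow J t).
Proof.
move=> Scyc Sodd kt sub.
have J_S : J `<=` order_ge S #|S|.+1./2.
  apply: ideal_gen_min; first exact: order_ge_is_ideal.
  move=> _ [C covC ->]; rewrite prod_vertex_var; apply/order_ge_monomial.
  have := odd_cycle_cover Scyc Sodd covC.
  suff -> : (\sum_(x in S) (x \in C) = #|(S :&: C)%SET|)%N by lia.
  by rewrite -sum1_card -big_mkcondr; apply: eq_bigl => x; rewrite !inE.
have := order_ge_pow J_S (sub _ (constant_monomial_symbolic k)).
move/order_ge_monomial; rewrite sum_nat_const.
have : #|S|.+1 = (#|S|.+1./2).*2 by move: Sodd; lia.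
by move: (#|S|.+1./2) kt => h; nia.
Qed.
End CoverIdeal.

(** * The two suprema *)

Section Supremum.
Local Open Scope ereal_scope.

(** The ratio of s = 2k(n+1) to t = 2kn+1 falls short of (n+1)/n by
    (n+1) / (n (2kn+1)), which tends to 0; this t is the least one
    with n s < (n+1) t. *)
Lemma ereal_sup_ratio (R : realType) (n : nat) (Q : set (\bar R)) :
  (0 < n)%N ->
  (forall q, Q q -> q <= (n.+1%:R / n%:R)%:E) ->
  (forall k, (0 < k)%N ->
     Q ((k * n.+1 + k * n.+1)%:R / (k * n + k * n).+1%:R)%:E) ->
  ereal_sup Q = (n.+1%:R / n%:R)%:E.
Proof.
move=> n_gt0 Qle Qk; apply/eqP; rewrite eq_le ge_ereal_sup //=.
apply/lee_addgt0Pr => eps eps_gt0.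
(* The defect is at most 1/k since n + 1 <= 2n; the choice of k has room to
   spare. *)
have [k k_gt0 k_eps] : exists2 k, (0 < k)%N & (2 / eps < k%:R)%R.
  exists (Num.bound (2 / eps)%R).+1 => //.
  apply: lt_le_trans (archi_boundP _) _; first by rewrite divr_ge0 // ltW.
  by rewrite ler_nat.
have := ereal_sup_ubound (Qk k k_gt0) => /(leeD2r eps%:E); apply: le_trans.
rewrite -EFinD lee_fin.
have n0 : (1 <= n%:R :> R)%R by rewrite ler1n.
have k0 : (1 <= k%:R :> R)%R by rewrite ler1n.
have ke : (2 < k%:R * eps)%R by rewrite -ltr_pdivrMr.
rewrite -!natr1 !natrD !natrM -!natr1.
set N := (n%:R : R)%R in n0 *; set M := (k%:R : R)%R in k0 ke *.
have D0 : (0 < M * N + M * N + 1)%R by nra.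
rewrite -lerBlDl.
have -> : ((N + 1) / N - (M * (N + 1) + M * (N + 1)) / (M * N + M * N + 1)
          = (N + 1) / (N * (M * N + M * N + 1)))%R.
  by field; rewrite !gt_eqF //; lra.
rewrite ler_pdivrMr; last by apply: mulr_gt0 => //; lra.
have : (2 * N <= (M * eps) * N)%R by nra.
by nra.
Qed.
End Supremum.

Theorem theorem4p11 (R : realType) (K : fieldType) (V : finType) (e : rel V)
    (n : nat)
    (e_simple : simple_graph e)
    (e_noisol : no_isolated_vertex e)
    (e_connected : connected_graph e)
    (e_cactus : cactus e)
    (e_nonbip : ~ bipartite e)
    (n_smallest : smallest_induced_odd_cycle_size e n) :
  [/\ resurgence R (cover_ideal K e) = (n.+1%:R / n%:R)%:E,
      asymptotic_resurgence R (cover_ideal K e) = (n.+1%:R / n%:R)%:E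
    & forall t : nat, (0 < t)%N ->
        symbolic_pow (cover_ideal K e) (n * t + t)
          `<=` ideal_pow (cover_ideal K e) (n * t)].
Proof.
have [[S [Scyc Sodd Sn]] n_min] := n_smallest.
have n_gt0 : (0 < n)%N by rewrite -Sn; case: #|S| Sodd.
have sub s t : (0 < t)%N -> (n.+1 * t <= n * s)%N ->
    symbolic_pow (cover_ideal K e) s `<=` ideal_pow (cover_ideal K e) t.
  exact: symbolic_pow_sub.
have ratio_le (s t : nat) : (0 < t)%N ->
    ~ (symbolic_pow (cover_ideal K e) s `<=` ideal_pow (cover_ideal K e) t) ->
    ((s%:R / t%:R)%:E <= (n.+1%:R / n%:R : R)%:E)%E.
  move=> t_gt0 nsub; rewrite lee_fin ler_pdivrMr ?ltr0n // mulrAC.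
  rewrite ler_pdivlMr ?ltr0n // -!natrM ler_nat mulnC leqNgt.
  by apply/negP => lt_nt; apply: nsub; apply: sub => //; apply: ltnW.
have not_sub k r : (0 < k)%N -> (0 < r)%N ->
    ~ (symbolic_pow (cover_ideal K e) ((k * n.+1 + k * n.+1) * r)
       `<=` ideal_pow (cover_ideal K e) ((k * n + k * n).+1 * r)).
  move=> k_gt0 r_gt0; rewrite mulnDl.
  by apply: (symbolic_pow_even_not_sub e_simple Scyc Sodd); rewrite Sn; nia.
split.
- apply: ereal_sup_ratio => // [q|k k_gt0].
    by move=> [s [t [_ t_gt0 nsub ->]]]; apply: ratio_le.
  exists (k * n.+1 + k * n.+1)%N, (k * n + k * n).+1; split=> //; first by lia.
  by have := @not_sub k 1%N k_gt0 isT; rewrite !muln1.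
- apply: ereal_sup_ratio => // [q|k k_gt0].
    move=> [s [t [s_gt0 t_gt0 [r0 nsub] ->]]].
    (* One large multiple of the pair (s, t) already bounds the ratio. *)
    have -> : (s%:R / t%:R = (s * r0.+1)%:R / (t * r0.+1)%:R :> R)%R.
      by rewrite !natrM -mulf_div divff ?mulr1 // pnatr_eq0.
    by apply: ratio_le; rewrite ?muln_gt0 ?t_gt0 //; apply: nsub.
  exists (k * n.+1 + k * n.+1)%N, (k * n + k * n).+1; split=> //; first by lia.
  by exists 1%N => r r_gt0; apply: not_sub.
move=> t t_gt0; apply: sub; first by rewrite muln_gt0 n_gt0.
by nia.
Qed.
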